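(* Let $K$ be an infinite field with $|\mathrm{Aut}(K)|<|K|$. Then $K$ has infinitely many maximal subrings up to isomorphism. In fact, $K$ has at least $|K|$-many pairwise non-isomorphic integrally closed maximal subrings.
   Context: All rings are commutative with $1\neq 0$; subrings and homomorphisms are unital. A proper subring $S$ of a ring $R$ is a maximal subring of $R$ if it is maximal with respect to inclusion among the proper subrings of $R$. An integrally closed maximal subring of $K$ is a maximal subring of $K$ that is integrally closed in $K$. $\mathrm{Aut}(K)$ is the set of all field automorphisms of $K$. ''Up to isomorphism'' and ''non-isomorphic'' refer to ring isomorphism. *)

(* Defs.v *)
From HB Require Import structures.
From mathcomp Require Import all_boot all_order all_algebra.
From mathcomp Require Import boolp classical_sets functions cardinality.

Set Implicit Arguments.
Unset Strict Implicit.
Unset Printing Implicit Defensive.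

Import GRing.Theory.
Local Open Scope ring_scope.
Local Open Scope classical_set_scope.
Local Open Scope card_scope.

(* A unital subring of [K] is an element of the library type [subringClosed K]:
   a predicate on [K] containing 1 and closed under subtraction and product.
   [subring_sort S] is its carrier, with the commutative ring structure
   inherited from [K]. *)
Record subring_sort (K : fieldType) (S : subringClosed K) : Type :=
  SubringSort { subring_val : K; subring_valP : subring_val \in S }.

HB.instance Definition _ (K : fieldType) (S : subringClosed K) :=
  [isSub for @subring_val K S].
HB.instance Definition _ (K : fieldType) (S : subringClosed K) :=
  [Choice of subring_sort S by <:].
HB.instance Definition _ (K : fieldType) (S : subringClosed K) :=
  [SubChoice_isSubComNzRing of subring_sort S by <:].

Definition ring_isomorphic (R S : nzRingType) : Prop :=
  exists f : {rmorphism R -> S}, bijective f.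

Definition subring_isomorphic (K : fieldType) (S T : subringClosed K) : Prop :=
  ring_isomorphic (subring_sort S) (subring_sort T).

Definition proper_subring (K : fieldType) (S : subringClosed K) : Prop :=
  exists x : K, x \notin S.

Definition maximal_subring (K : fieldType) (S : subringClosed K) : Prop :=
  proper_subring S /\
  forall T : subringClosed K,
    proper_subring T -> {subset S <= T} -> {subset T <= S}.

Definition integrally_closed_in (K : fieldType) (S : subringClosed K) : Prop :=
  forall x : K, integralOver (@subring_val K S) x -> x \in S.

Definition field_aut (K : fieldType) : set (K -> K) :=
  [set f : K -> K |
    exists g : {rmorphism K -> K}, bijective g /\ f = g :> (K -> K)].
Arguments field_aut : clear implicits.

Definition card_lt (T U : Type) (A : set T) (B : set U) : Prop :=
  (A #<= B) /\ ~ (B #<= A).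

Definition maximal_subring_classes (K : fieldType) :
    set (set (subringClosed K)) :=
  [set [set T | subring_isomorphic S T] | S in [set S | maximal_subring S]].
Arguments maximal_subring_classes : clear implicits.

(* Main.v *)
Require Import Defs.
From HB Require Import structures.
From mathcomp Require Import all_boot all_order all_algebra.
From mathcomp Require Import polyXY.
From mathcomp Require Import boolp classical_sets functions cardinality.

Set Implicit Arguments.
Unset Strict Implicit.
Unset Printing Implicit Defensive.

Import GRing.Theory.
Local Open Scope ring_scope.
Local Open Scope classical_set_scope.
Local Open Scope card_scope.

(* If K is algebraic over the fraction field of a principal ideal domain A
   inside K and p is prime in A, a subring V of K containing A and maximal among
   those avoiding 1/p is a valuation ring. It is a maximal subring because every
   larger ring contains Frac A and is integrally closed, and V determines p up
   to a unit. If K is algebraic over Q, take A = Z. If K is algebraic over F_p,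
   it is countable and the powers of Frobenius give infinitely many
   automorphisms, which is excluded. Otherwise pick t transcendental over the
   prime ring and take A = E[t] with E maximal among the subrings over which t
   is transcendental; E is a field and K is algebraic over E(t). The primes
   t - c (or all monic irreducibles, if E is finite) are as many as K. Finally,
   an isomorphism between valuation rings of K extends to an automorphism of K, so
   each isomorphism class among these |K| rings has at most |Aut K| < |K|
   members, and there are |K| classes since |K|^2 = |K|. *)

(** * Cardinal comparison by injections *)

Definition injects (A B : Type) : Prop := exists f : A -> B, injective f.

Lemma injects_trans (B A C : Type) : injects A B -> injects B C -> injects A C.
Proof. by move=> [f fI] [g gI]; exists (g \o f); exact: inj_comp. Qed.

Lemma injects_prod (A A' B B' : Type) :
  injects A A' -> injects B B' -> injects (A * B) (A' * B').
Proof.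
move=> [f fI] [g gI]; exists (fun p => (f p.1, g p.2)).
by move=> [a b] [a' b'] /= [/fI -> /gI ->].
Qed.

Lemma injects_card_le (T U : Type) (A : set T) (B : set U) (f : T -> U) :
  (forall x, A x -> B (f x)) ->
  (forall x y, A x -> A y -> f x = f y -> x = y) ->
  A #<= B.
Proof.
move=> fAB fI; have /injfunPex[g] :
    exists2 f : T -> U, set_fun A B f & set_inj A f.
  by exists f => // x y /set_mem Ax /set_mem Ay; exact: fI.
exact: inj_card_le g.
Qed.

Lemma injects_sig_card_le (T U : Type) (A : set U) :
  injects T {x | A x} -> [set: T] #<= A.
Proof.
move=> [f fI]; apply: (injects_card_le (f := fun x => sval (f x))).
  by move=> x _; exact: svalP.
move=> x y _ _ E; apply: fI; case: (f x) (f y) E => [u Pu] [v Pv] /= E.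
exact: eq_exist.
Qed.

Lemma infinite_seq (T : Type) (A : set T) :
  infinite_set A -> exists a : nat -> T, injective a /\ forall n, A (a n).
Proof.
move=> /infiniteP/card_leP[g].
exists (fun n => val (g (SigSub (mem_set (I : [set: nat] n))))).
split=> [m n /val_inj/(@inj _ _ _ g)|n].
  by rewrite !inE => /(_ I I) /(congr1 val).
by apply: set_mem; exact: valP.
Qed.

Lemma injects_nat_infinite (T : Type) :
  injects nat T <-> infinite_set [set: T].
Proof.
split=> [[f fI]|/infinite_seq[f [fI _]]]; last by exists f.
by apply/infiniteP/(injects_card_le (f := f)) => // x y _ _ /fI.
Qed.

(** Zorn's lemma on graphs of partial injections: a maximal graph is defined on all of [A] or
    reaches all of [B], since otherwise a missed [a] and a missed [b] could be paired. *)
Lemma injects_total (A B : Type) : injects A B \/ injects B A.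
Proof.
pose P (R : set (A * B)) := (forall x y y', R (x, y) -> R (x, y') -> y = y') /\
                            (forall x x' y, R (x, y) -> R (x', y) -> x = x').
have [F PF Ftot|R [[Rf Ri] Rmax]] := @Zorn_bigcup _ P.
  split=> [x y y'|x x' y] [X FX Xxy] [Y FY Yxy];
    have [XY|YX] := Ftot _ _ FX FY.
  - exact: (PF _ FY).1 (XY _ Xxy) Yxy.
  - exact: (PF _ FX).1 Xxy (YX _ Yxy).
  - exact: (PF _ FY).2 (XY _ Xxy) Yxy.
  - exact: (PF _ FX).2 Xxy (YX _ Yxy).
have [tot|/existsNP[a Ra]] := pselect (forall x, exists y, R (x, y)).
  left; have [f Rfx] := choice tot; exists f => x y fxy.
  by apply: Ri (Rfx x) _; rewrite fxy.
have [tot|/existsNP[b Rb]] := pselect (forall y, exists x, R (x, y)).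
  right; have [f Rfx] := choice tot; exists f => x y fxy.
  by apply: Rf (Rfx x) _; rewrite fxy.
exfalso; apply: (Rmax (R `|` [set (a, b)])).
  split=> [|/(_ (a, b))]; first exact: subsetUl.
  by move=> Rab; apply: Ra; exists b; apply: Rab; right.
split=> [x y y'|x x' y] [Rxy|[xE yE]] [Rxy'|[xE' yE']].
- exact: Rf Rxy Rxy'.
- by case: Ra; exists y; rewrite -xE'.
- by case: Ra; exists y'; rewrite -xE.
- by rewrite yE yE'.
- exact: Ri Rxy Rxy'.
- by case: Rb; exists x; rewrite -yE'.
- by case: Rb; exists x'; rewrite -yE.
- by rewrite xE xE'.
Qed.

Lemma injects_nat2 : injects (nat * nat) nat.
Proof. by exists pickle; exact: pcan_inj pickleK. Qed.

(* A maximal injection A * A -> A, with A a subset of M, has a complement of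
   size at most that of A: otherwise it extends to the union of A and a
   disjoint copy of A. *)
Lemma injects_square (M : Type) : injects nat M -> injects (M * M) M.
Proof.
move=> [f fI]; have [pair pairI] := injects_nat2.
pose dom (R : set ((M * M) * M)) : set M := [set x | exists z, R ((x, x), z)].
(* [P R] says that [R] is the graph of an injection from [D * D] to [D], where [D = dom R] contains
   the image of [f]; [R0] is the graph transported from [nat]. *)
pose P (R : set ((M * M) * M)) :=
  [/\ forall p z z', R (p, z) -> R (p, z') -> z = z',
      forall p p' z, R (p, z) -> R (p', z) -> p = p',
      forall x y z, R ((x, y), z) -> [/\ dom R x, dom R y & dom R z],
      forall x y, dom R x -> dom R y -> exists z, R ((x, y), z)
    & forall n, dom R (f n)].
pose R0 : set ((M * M) * M) :=
  [set p | exists i j, p = ((f i, f j), f (pair (i, j)))].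
have domR0 n : dom R0 (f n) by exists (f (pair (n, n))); exists n, n.
have domR0P x : dom R0 x -> exists n, x = f n.
  by move=> [z [i [j [-> _ _]]]]; exists i.
have PR0 : P R0.
  split=> //.
  - by move=> p z z' [i [j [-> ->]]] [i' [j' [/fI -> /fI -> ->]]].
  - by move=> p p' z [i [j [-> ->]]] [i' [j' [-> /fI/pairI[-> ->]]]].
  - by move=> x y z [i [j [-> -> ->]]]; split.
  - move=> x y /domR0P[i ->] /domR0P[j ->].
    by exists (f (pair (i, j))); exists i, j.
have [F PF Ftot|R [PR Rmax]] :=
  @Zorn_bigcup _ [set R | R = set0 \/ P R].
  have [F0|/existsNP[X0 /not_implyP[FX0 X00]]] :=
    pselect (forall X, F X -> X = set0).
    by left; apply/seteqP; split=> // p [X /F0 ->].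
  right.
  have PFp X p : F X -> X p -> P X.
    by move=> FX Xp; case: (PF _ FX) => // XE; rewrite XE in Xp.
  have PX0 : P X0 by case: (PF _ FX0).
  have two p q : (\bigcup_(X in F) X) p -> (\bigcup_(X in F) X) q ->
      exists X, [/\ F X, P X, X p & X q].
    move=> [X FX Xp] [Y FY Yq]; have [XY|YX] := Ftot _ _ FX FY.
      by exists Y; split=> //; [exact: PFp Yq|exact: XY].
    by exists X; split=> //; [exact: PFp Xp|exact: YX].
  have dom_sub X x : F X -> dom X x -> dom (\bigcup_(X in F) X) x.
    by move=> FX [z Xz]; exists z; exists X.
  split.
  - by move=> p z z' Rz Rz'; have [X [_ [+ _ _ _ _] + +]] := two _ _ Rz Rz';
    apply.
  - by move=> p p' z Rz Rz'; have [X [_ [_ + _ _ _] + +]] := two _ _ Rz Rz';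
    apply.
  - move=> x y z [X FX Xz]; have [_ _ + _ _] := PFp _ _ FX Xz.
    by move=> /(_ _ _ _ Xz)[? ? ?]; split; exact: dom_sub FX _.
  - move=> x y [z Rz] [z' Rz'].
    have [X [FX [_ _ _ tX _] Xz Xz']] := two _ _ Rz Rz'.
    have [|| w Xw] := tX x y; [by exists z|by exists z'|by exists w; exists X].
  - by move=> n; case: PX0 => _ _ _ _ /(_ n) /(dom_sub _ _ FX0).
have {}PR : P R.
  case: PR => // R_0; exfalso; apply: (Rmax R0); last by right.
  rewrite R_0; split=> // R0_0.
  by have [z /R0_0] := domR0 0%N.
have [Rf Ri Rd Rt Rn] := PR; set A := dom R in Rd Rt Rn.
have [g gP] : {g : M * M -> M & forall p, A p.1 -> A p.2 -> R (p, g p)}.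
  apply: (choice (P := fun p z => A p.1 -> A p.2 -> R (p, z))) => -[x y] /=.
  have [Ax|nAx] := pselect (A x); last by exists x.
  have [Ay|nAy] := pselect (A y); last by exists x.
  by have [z Rz] := Rt _ _ Ax Ay; exists z.
have gA x y : A x -> A y -> A (g (x, y)).
  by move=> Ax Ay; have /(_ Ax Ay)/Rd[] := gP (x, y).
have gI x y x' y' : A x -> A y -> A x' -> A y' ->
    g (x, y) = g (x', y') -> x = x' /\ y = y'.
  move=> Ax Ay Ax' Ay' E; have /= Rxy := gP (x, y) Ax Ay.
  by have /= := gP (x', y') Ax' Ay'; rewrite -E => /(Ri _ _ _ Rxy)[-> ->].
pose c i := f i; have cA i : A (c i) by exact: Rn.
have [[h hI]|[k kI]] := injects_total {x | A x} {x | ~ A x}; last first.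
  have [k' k'P] : {k' : M -> M & forall x (nAx : ~ A x),
      k' x = sval (k (exist _ x nAx))}.
    apply: (choice (P := fun x z => forall nAx, z = sval (k (exist _ x nAx)))).
    move=> x; have [Ax|nAx] := pselect (A x); first by exists x.
    exists (sval (k (exist _ x nAx))) => nAx'.
    by congr (sval (k _)); exact: eq_exist.
  have k'A x : ~ A x -> A (k' x) by move=> nAx; rewrite k'P; exact: svalP.
  have k'I x y : ~ A x -> ~ A y -> k' x = k' y -> x = y.
    move=> nAx nAy; rewrite !k'P => E.
    have /kI[//] : k (exist _ x nAx) = k (exist _ y nAy).
    by move: E; case: (k _) => ? ?; case: (k _) => ? ? /= E; exact: eq_exist.
  (* Here the complement of [A] embeds in [A] by [k']. The tags [c 0] and [c 1] keep the images of
     [A] and of its complement apart, so [j] embeds all of [M] in [A], and [g] then embeds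
     [M * M]. *)
  pose j x := if pselect (A x) then g (x, c 0%N) else g (k' x, c 1%N).
  have jA x : A (j x).
    by rewrite /j; case: pselect => ?; apply: (gA) => //; exact: k'A.
  have jI : injective j.
    move=> x y; rewrite /j.
    case: pselect => Ax; case: pselect => Ay; move/gI; case=> //;
      try exact: k'A.
    - by move=> _ /fI.
    - by move=> _ /fI.
    - by move=> /k'I -> //.
  exists (fun p => g (j p.1, j p.2)) => -[x y] [x' y'] /=.
  by move=> /gI[] // /jI -> /jI ->.
exfalso.
have [h' h'P] : {h' : M -> M & forall x (Ax : A x),
    h' x = sval (h (exist _ x Ax))}.
  apply: (choice (P := fun x z => forall Ax, z = sval (h (exist _ x Ax)))).
  move=> x; have [Ax|nAx] := pselect (A x); last by exists x.
  exists (sval (h (exist _ x Ax))) => Ax'.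
  by congr (sval (h _)); exact: eq_exist.
have h'A x : A x -> ~ A (h' x) by move=> Ax; rewrite h'P;
  exact: (proj2_sig (h _)).
have h'I x y : A x -> A y -> h' x = h' y -> x = y.
  move=> Ax Ay; rewrite !h'P => E.
  have /hI[//] : h (exist _ x Ax) = h (exist _ y Ay).
  by move: E; case: (h _) => ? ?; case: (h _) => ? ? /= E; exact: eq_exist.
(* Now [h'] gives a copy of [A] disjoint from [A], and [e b] selects the original or the copy. The
   square of the union has three blocks outside [A * A], those with [b || b']; [S] sends them into
   the copy, with [tag] recording the block. *)
pose e (b : bool) x := if b then h' x else x.
pose tag (b b' : bool) := (b + b'.*2)%N.
pose S : set ((M * M) * M) := [set p | exists b b' x y,
  [/\ A x, A y, b || b' &
      p = ((e b x, e b' y), h' (g (g (x, y), c (tag b b'))))]].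
have eI b b' x x' : A x -> A x' -> e b x = e b' x' -> b = b' /\ x = x'.
  case: b b' => [] [] /= Ax Ax'.
  - by move/h'I => ->.
  - by move=> E; case: (h'A _ Ax); rewrite E.
  - by move=> E; case: (h'A _ Ax'); rewrite -E.
  - by [].
have tagI b b' d d' : tag b b' = tag d d' -> b = d /\ b' = d'.
  by case: b b' d d' => [] [] [] [].
have RA p z : R (p, z) -> A z by case: p => x y /Rd[].
have nRS p z z' : R (p, z) -> S (p, z') -> False.
  move=> Rz [b [b' [x [y [Ax Ay bb' [pE _]]]]]].
  move: Rz; rewrite pE => /Rd[].
  by case: b b' bb' {pE} => [] [] //= _ ? ? _; [apply: (h'A _ Ax) _|
    apply: (h'A _ Ax) _|apply: h'A Ay _].
have SA p z : S (p, z) -> ~ A z.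
  move=> [b [b' [x [y [Ax Ay bb' [_ ->]]]]]].
  by apply: (h'A); apply: (gA) => //; exact: (gA).
have domS x : A x -> dom (R `|` S) (h' x).
  move=> Ax; exists (h' (g (g (x, x), c (tag true true)))); right.
  by exists true, true, x, x; split.
have domR x : A x -> dom (R `|` S) x.
  by move=> [z Rz]; exists z; left.
have dom_e b x : A x -> dom (R `|` S) (e b x).
  by case: b => Ax; [exact: domS|exact: domR].
have domE x : dom (R `|` S) x -> exists b y, A y /\ x = e b y.
  move=> [z [/Rd[Ax _ _]|[b [b' [u [v [Au _ _ [-> _ _]]]]]]]].
    by exists false, x.
  by exists b, u.
apply: (Rmax (R `|` S)).
  split=> [|RS]; first exact: subsetUl.
  by have [z /RS/Rd[/(h'A _ (cA 0%N))]] := domS (c 0%N) (cA 0%N).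
right; split.
- move=> p z z' [Rz|Sz] [Rz'|Sz'].
  + exact: Rf Rz Rz'.
  + by case: (nRS _ _ _ Rz Sz').
  + by case: (nRS _ _ _ Rz' Sz).
  + move: Sz Sz' => [b [b' [x [y [Ax Ay _ [-> ->]]]]]].
    move=> [d [d' [u [v [Au Av _ [+ + ->]]]]]].
    by move=> /eI[//|//|-> ->] /eI[//|//|-> ->].
- move=> p p' z [Rz|Sz] [Rz'|Sz'].
  + exact: Ri Rz Rz'.
  + by case: (SA _ _ Sz'); exact: RA Rz.
  + by case: (SA _ _ Sz); exact: RA Rz'.
  + move: Sz Sz' => [b [b' [x [y [Ax Ay _ [-> ->]]]]]].
    move=> [d [d' [u [v [Au Av _ [-> E]]]]]].
    have guv u1 v1 d1 : A u1 -> A v1 -> A (g (g (u1, v1), c d1)).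
      by move=> ? ?; apply: (gA) => //; exact: (gA).
    have [] := gI _ _ _ _ _ _ _ _ (h'I _ _ _ _ E); try exact: guv;
      try (exact: gA || exact: cA).
    by move=> /gI[]// -> -> /fI/tagI[-> ->].
- move=> x y z [/Rd[? ? ?]|]; first by split; exact: domR.
  move=> [b [b' [u [v [Au Av _ [-> -> ->]]]]]]; split; try exact: dom_e.
  by apply: domS; apply: (gA) => //; exact: (gA).
- move=> x y /domE[b [u [Au ->]]] /domE[b' [v [Av ->]]].
  case: (boolP (b || b')) => bb'.
    exists (h' (g (g (u, v), c (tag b b')))); right.
    by exists b, b', u, v.
  by case: b b' bb' => [] [] //= _; have [z Rz] := Rt _ _ Au Av; exists z; left.
- by move=> n; exact: domR.
Qed.

(** A list is coded by iterated pairing. Its length is stored as well, since the code [f 0] of the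
    empty list may also be the code of a pair. *)
Lemma injects_seq (T M : Type) :
  injects nat M -> injects T M -> injects (seq T) M.
Proof.
move=> natM [h hI]; have [f fI] := natM; have [g gI] := injects_square natM.
pose enc := foldr (fun x m => g (h x, m)) (f 0%N).
exists (fun s => g (f (size s), enc s)) => s t /gI[/fI].
elim: s t => [|x s IH] [|y t] //= [sz] /gI[/hI -> /IH]-/(_ sz) -> //.
Qed.

Lemma injects_finite (T : Type) (A B : Type) :
  injects nat T -> injects T (A * B) -> injects nat A \/ injects nat B.
Proof.
move=> natT /(injects_trans natT)/injects_nat_infinite; rewrite -setXTT.
have [finA|infA] := pselect (finite_set [set: A]); last first.
  by move=> _; left; apply/injects_nat_infinite.
have [finB|infB] := pselect (finite_set [set: B]); last first.
  by move=> _; right; apply/injects_nat_infinite.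
by case; exact: finite_setX.
Qed.

(** The larger of the two factors is infinite because [T] is, so it absorbs its own square and hence
    the product. *)
Lemma injects_prod_or (T A B : Type) :
  injects nat T -> injects T (A * B) -> injects T A \/ injects T B.
Proof.
move=> natT TAB; have TM M : injects A M -> injects B M -> injects T M.
  move=> AM BM; apply: (injects_trans TAB).
  apply: (injects_trans (injects_prod AM BM)); apply: injects_square.
  by have [/injects_trans|/injects_trans] := injects_finite natT TAB; apply.
have id_inj M : injects M M by exists id.
by have [AB|BA] := injects_total A B; [right|left]; apply: TM.
Qed.

(* T embeds into the product of a system of representatives and G. *)
Lemma injects_small_classes (T : choiceType) (G : Type) (e : T -> T -> Prop)
    (c : T -> T -> G) :
  injects nat T -> ~ injects T G ->
  (forall x, e x x) -> (forall x y, e x y -> e y x) ->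
  (forall x y z, e x y -> e y z -> e x z) ->
  (forall x y z, e x y -> e x z -> c x y = c x z -> y = z) ->
  exists s : T -> T, forall x y, e (s x) (s y) -> x = y.
Proof.
move=> natT nTG e_refl e_sym e_trans cI.
have [t0 _] := natT; pose x0 := t0 0%N.
pose r x := xget x0 (e x).
have er x : e x (r x) by apply: (@xgetPex _ x0 (e x)); exists x.
have rE x y : e x y -> r x = r y.
  move=> exy; congr (xget x0 _); apply/seteqP.
  by split=> z; apply: e_trans => //; exact: e_sym.
(* Within a class, [c (r x)] is injective, so [x] is recovered from its representative [r x] and the
   value [c (r x) x]. As [G] is too small, the representatives must be as many as [T]. *)
have : injects T ({x | exists y, r y = x} * G).
  exists (fun x => (exist _ (r x) (ex_intro _ x erefl), c (r x) x)) => x y.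
  case=> rxy; rewrite rxy; apply: cI; last exact: e_sym.
  by rewrite -rxy; exact: e_sym.
case/(injects_prod_or natT) => // -[f fI].
exists (fun x => sval (f x)) => x y.
have rr p : r (sval (f p)) = sval (f p) by case: (f p) => _ /= [u <-];
  exact/esym/rE.
by move=> /rE; rewrite !rr => fxy; apply: fI; apply: eq_sig_hprop fxy.
Qed.

(** * Constructing subrings of a field *)

Lemma subring_of_set (K : fieldType) (A : set K) :
  A 1 -> (forall x y, A x -> A y -> A (x - y)) ->
  (forall x y, A x -> A y -> A (x * y)) ->
  exists S : subringClosed K, forall x, x \in S <-> A x.
Proof.
move=> A1 AB AM; pose S : K -> bool := fun x => `[< A x >].
have S_closed : subring_closed S.
  split; first exact/asboolP.
    by move=> x y /asboolP Ax /asboolP Ay; apply/asboolP; exact: AB.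
  by move=> x y /asboolP Ax /asboolP Ay; apply/asboolP; exact: AM.
pose T : subringClosed K := HB.pack S (GRing.isSubringClosed.Build K S
  S_closed).
by exists T => x; split=> /asboolP.
Qed.

Lemma subring_image (R : nzRingType) (K : fieldType)
    (phi : {rmorphism R -> K}) :
  exists S : subringClosed K, forall x, x \in S <-> exists a, x = phi a.
Proof.
apply: subring_of_set; first by exists 1; rewrite rmorph1.
  by move=> _ _ [a ->] [b ->]; exists (a - b); rewrite rmorphB.
by move=> _ _ [a ->] [b ->]; exists (a * b); rewrite rmorphM.
Qed.

Lemma subring_adjoin (K : fieldType) (S : subringClosed K) (y : K) :
  exists T : subringClosed K,
    [/\ {subset S <= T}, y \in T
      & forall x, x \in T ->
          exists2 q : {poly K}, q \is a polyOver S & x = q.[y]].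
Proof.
have [||| T TP] := @subring_of_set K
    [set x | exists2 q : {poly K}, q \is a polyOver S & x = q.[y]].
- by exists 1; rewrite ?rpred1 ?hornerC.
- by move=> _ _ [p pS ->] [q qS ->]; exists (p - q); rewrite ?rpredB ?hornerE.
- by move=> _ _ [p pS ->] [q qS ->]; exists (p * q); rewrite ?rpredM ?hornerE.
exists T; split=> [x Sx||x /TP//]; apply/TP.
  by exists x%:P; rewrite ?polyOverC ?hornerC.
by exists 'X; rewrite ?polyOverX ?hornerX.
Qed.

(** A condition on finite lists passes to the union of a chain, because a finite list in the union
    already lies in one member. *)
Lemma Zorn_subring (K : fieldType) (Q : seq K -> Prop) (S0 : subringClosed K) :
  (forall s, {subset s <= S0} -> Q s) ->
  exists S : subringClosed K,
    [/\ {subset S0 <= S}, forall s, {subset s <= S} -> Q s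
      & forall T : subringClosed K, {subset S <= T} ->
          (forall s, {subset s <= T} -> Q s) -> {subset T <= S}].
Proof.
move=> QS0.
pose P (A : set K) := exists S : subringClosed K,
  [/\ A = [set x | x \in S], {subset S0 <= S}
    & forall s, {subset s <= S} -> Q s].
have [F PF Ftot|A [PA Amax]] := @Zorn_bigcup _ [set A | A = set0 \/ P A].
  have [F0|/existsNP[X0 /not_implyP[FX0 X00]]] :=
    pselect (forall X, F X -> X = set0).
    by left; apply/seteqP; split=> // x [X /F0 ->].
  right; have PX X : F X -> X !=set0 -> P X.
    by move=> FX [x Xx]; case: (PF _ FX) => // XE; rewrite XE in Xx.
  have PX0 : P X0 by case: (PF _ FX0).
  have [S1 [X0E S01 _]] := PX0.
  have all_in (s : seq K) : (forall x, x \in s -> (\bigcup_(X in F) X) x) ->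
      exists X, [/\ F X, P X & forall x, x \in s -> X x].
    elim: s => [_|x s IH xsF].
      by exists X0; split.
    have [|X [FX PX' sX]] := IH; first by move=> y ys; apply: xsF;
      rewrite inE ys orbT.
    have [Y FY Yx] := xsF x (mem_head _ _); have [XY|YX] := Ftot _ _ FX FY.
      exists Y; split=> // [|y]; first by apply: PX => //; exists x.
      by rewrite inE => /predU1P[->//|/sX/XY].
    exists X; split=> // y.
    by rewrite inE => /predU1P[->|/sX//]; exact: YX.
  have [||| S SP] := @subring_of_set K (\bigcup_(X in F) X).
  - by exists X0 => //; rewrite X0E /= rpred1.
  - move=> x y Fx Fy; have [|X [FX [S [XE _ _]] xyX]] := all_in [:: x; y].
      by move=> z; rewrite !inE => /orP[]/eqP ->.
    have := xyX x; have := xyX y;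
      rewrite !inE !eqxx orbT XE => /(_ isT) /= Sy /(_ isT) Sx.
    by exists X => //; rewrite XE /= rpredB.
  - move=> x y Fx Fy; have [|X [FX [S [XE _ _]] xyX]] := all_in [:: x; y].
      by move=> z; rewrite !inE => /orP[]/eqP ->.
    have := xyX x; have := xyX y;
      rewrite !inE !eqxx orbT XE => /(_ isT) /= Sy /(_ isT) Sx.
    by exists X => //; rewrite XE /= rpredM.
  exists S; split.
  - by apply/seteqP; split=> x /SP.
  - by move=> x /S01 S1x; apply/SP; exists X0 => //; rewrite X0E.
  - move=> s sS; have [x /sS/SP//|X [_ [S2 [XE _ QS2]] sX]] := all_in s.
    by apply: QS2 => x /sX; rewrite XE.
have : P A.
  case: PA => // A0; exfalso; apply: (Amax [set x | x \in S0]); last first.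
    by right; exists S0; split.
  by rewrite A0; split=> // /(_ 1); apply; rewrite /= rpred1.
move=> [S [AE S0S QS]]; exists S; split=> // T ST QT x Tx.
apply: contrapT => /negP xS; apply: (Amax [set y | y \in T]).
  rewrite AE; split=> [y /ST//|/(_ x Tx)/=]; exact/negP.
by right; exists T; split=> // y /S0S/ST.
Qed.

(** * Valuation subrings, and subrings maximal among those avoiding [p^-1] *)

Definition valuation_subring (K : fieldType) (V : subringClosed K) : Prop :=
  forall y, y \in V \/ y^-1 \in V.

Definition maximal_avoiding (K : fieldType) (p : K) (V : subringClosed K) :
  Prop :=
  [/\ p \in V, p^-1 \notin V
    & forall T : subringClosed K,
        {subset V <= T} -> p^-1 \notin T -> {subset T <= V}].

Lemma exists_maximal_avoiding (K : fieldType) (p : K) (A : subringClosed K) :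
  p \in A -> p^-1 \notin A ->
  exists2 V : subringClosed K, {subset A <= V} & maximal_avoiding p V.
Proof.
move=> Ap nAp.
have [s|V [AV QV Vmax]] := @Zorn_subring K (fun s => p^-1 \notin s) A.
  by move=> sA; apply: contra nAp; exact: sA.
exists V => //; split; first exact: AV.
  by apply/negP => Vp; have := QV [:: p^-1]; rewrite inE eqxx => /(_ _)/negP[]//
    x; rewrite inE => /eqP ->.
by move=> T VT nTp; apply: Vmax => // s sT; apply: contra nTp; exact: sT.
Qed.

Section PolyOver.
Variables (K : fieldType) (S : subringClosed K).

Lemma horner_inv_mem (q : {poly K}) (x : K) (n : nat) :
  q \is a polyOver S -> x \in S -> x != 0 -> (size q <= n.+1)%N ->
  q.[x^-1] * x ^+ n \in S.
Proof.
move=> /polyOverP qS xS x0 sq; rewrite (horner_coef_wide _ sq) mulr_suml.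
apply: rpred_sum => i _.
have -> : x ^+ n = x ^+ i * x ^+ (n - i) by rewrite -exprD subnKC // -ltnS.
by rewrite exprVn !mulrA mulfVK ?expf_neq0 // rpredM ?rpredX.
Qed.

(** If [x^-1] is in [S], dividing a monic equation of degree [n.+1] by [x ^+ n] expresses [x] as a
    polynomial in [x^-1] over [S]. *)
Lemma valuation_integral (q : {poly K}) (x : K) :
  valuation_subring S -> q \is a polyOver S -> q \is monic -> root q x ->
  x \in S.
Proof.
move=> /(_ x)[//|xS] qS qmon qx.
have [->|x0] := eqVneq x 0; first exact: rpred0.
have sq : (1 < size q)%N.
  rewrite ltnNge; apply/negP => sq; move: qmon qx.
  by rewrite (size1_polyC sq) monicE lead_coefC rootC => /eqP ->;
    rewrite oner_eq0.
set n := (size q).-2; have sqE : size q = n.+2 by rewrite /n;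
  case: (size q) sq => [|[]].
have qE : q = 'X^(n.+1) + \poly_(i < n.+1) q`_i.
  rewrite -[LHS]coefK sqE poly_def big_ord_recr /= addrC -poly_def.
  by have := monicP qmon; rewrite lead_coefE sqE /= => ->; rewrite scale1r.
have := @horner_inv_mem (\poly_(i < n.+1) q`_i) x^-1 n.
rewrite invrK => /(_ _ xS); rewrite invr_neq0 // size_poly => /(_ _ isT isT).
have -> : (\poly_(i < n.+1) q`_i).[x] = - x ^+ n.+1.
  by move: qx; rewrite {1}qE rootE hornerD hornerXn addr_eq0 => /eqP ->;
    rewrite opprK.
rewrite exprS exprVn mulNr mulfK ?expf_neq0 // rpredN; apply.
by apply/polyOverP => i; rewrite coef_poly; case: ifP => // _;
  [exact/polyOverP|exact: rpred0].
Qed.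

End PolyOver.

Section Avoiding.
Variables (K : fieldType) (p : K) (V : subringClosed K).
Hypothesis Vmax : maximal_avoiding p V.

Let pV : p \in V. Proof. by case: Vmax. Qed.
Let npV : p^-1 \notin V. Proof. by case: Vmax. Qed.

Let p_neq0 : p != 0.
Proof. by apply: contraNneq npV => ->; rewrite invr0 rpred0. Qed.

(** The ring obtained by adjoining [y] to [V] is strictly larger, so by maximality it contains
    [p^-1]. *)
Lemma avoiding_inv_horner (y : K) :
  y \notin V -> exists2 q : {poly K}, q \is a polyOver V & p^-1 = q.[y].
Proof.
move=> yV; have [T [VT yT TP]] := subring_adjoin V y.
apply: TP; apply: contraNT yV => pT; have [_ _ /(_ T VT pT)] := Vmax; exact.
Qed.

(** Otherwise [p^-1] is a polynomial value at the inverse of [u = 1 - p * c]. Multiplying by a large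
    power [u ^+ n], which has the form [1 - p * d], puts [p^-1 - d] and hence [p^-1] in [V]. *)
Lemma avoiding_unit (c : K) : c \in V -> (1 - p * c)^-1 \in V.
Proof.
move=> cV; set u := 1 - p * c.
have uV : u \in V by rewrite rpredB ?rpred1 ?rpredM.
have un n : exists2 d, d \in V & u ^+ n = 1 - p * d.
  elim: n => [|n [d dV IH]]; first by exists 0; rewrite ?rpred0 // mulr0 subr0.
  exists (d + c - p * (d * c)); first by rewrite rpredB ?rpredD ?rpredM.
  rewrite exprS IH /u mulrBl mul1r !mulrBr mulr1 mulrDr !opprD opprK !addrA.
  by rewrite -!mulrA [c * (p * d)]mulrCA [c * d]mulrC opprK.
have u0 : u != 0.
  apply: contraNneq npV => /eqP; rewrite subr_eq0 => /eqP pc.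
  by rewrite (_ : p^-1 = c) // -[LHS]mulr1 pc mulKf.
have [//|/avoiding_inv_horner[q qV pE]] := boolP (u^-1 \in V).
have := horner_inv_mem qV uV u0 (leqnSn _); rewrite -pE.
have [d dV ->] := un (size q); rewrite mulrBr mulr1 mulKf // => pdV.
by case/negP: npV; rewrite -(subrK d p^-1) rpredD.
Qed.

(* With y and y^-1 both outside V, 1/p is a polynomial value at y and at y^-1;
   the shorter of these lowers the degree of the longer. *)
Lemma avoiding_no_both (N : nat) (y : K) (q r : {poly K}) :
  (size q + size r < N)%N -> q \is a polyOver V -> r \is a polyOver V ->
  p^-1 = q.[y] -> p^-1 = r.[y^-1] -> False.
Proof.
elim: N y q r => // N IH y q r.
(* The situation is symmetric under exchanging [(y, q)] with [(y^-1, r)]. *)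
wlog srq : y q r / (size r <= size q)%N.
  move=> wl sN qV rV qy ry; have [srq|sqr] := leqP (size r) (size q).
    exact: (wl y q r).
  by apply: (wl y^-1 r q); rewrite ?invrK // ?(ltnW sqr) // addnC.
move=> sN qV rV qy ry; have y0 : y != 0.
  apply: contraNneq npV => y0; rewrite qy y0 horner_coef0; exact/polyOverP.
have cst (g : {poly K}) z :
  g \is a polyOver V -> p^-1 = g.[z] -> (1 < size g)%N.
  move=> gV gz; rewrite ltnNge; apply: contra npV => sg.
  by rewrite gz (size1_polyC sg) hornerC; exact/polyOverP.
have := cst _ _ qV qy; have := cst _ _ rV ry.
case nE: (size q) => [|n] //; case mE: (size r) => [|m] // m0 n0.
have mn : (m <= n)%N by rewrite -ltnS -nE -mE.
have r0V : (1 - p * r`_0)^-1 \in V by apply: avoiding_unit; exact/polyOverP.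
set u := 1 - p * r`_0 in r0V.
have u0 : u != 0.
  apply: contraNneq npV => /eqP; rewrite subr_eq0 => /eqP pc.
  by rewrite (_ : p^-1 = r`_0) ?(polyOverP rV) // -[LHS]mulr1 pc mulKf.
(* Multiplying the relation at [y^-1] by [p] gives [u] as a sum of multiples of negative powers of
   [y], with exponents from 1 to [m]. As [u] is a unit and [m <= n], this rewrites [y ^+ n] through
   lower nonnegative powers; [q'] is [q] with its leading term replaced accordingly. *)
pose q' := \poly_(i < n) q`_i +
  \sum_(i < m) (q`_n * u^-1 * p * r`_i.+1) *: 'X^(n - i.+1).
have sq' : (size q' <= n)%N.
  rewrite (leq_trans (size_polyD _ _)) // geq_max size_poly /=.
  apply: (leq_trans (size_sum _ _ _)); apply/bigmax_leqP => i _;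
    rewrite (leq_trans (size_scale_leq _ _)) //.
  by rewrite size_polyXn ltn_subrL /= (leq_trans _ mn) // (leq_ltn_trans _
    (ltn_ord i)).
apply: (IH y q' r) => //.
- by rewrite ltnS in sN; apply: leq_trans sN; rewrite nE -addSn leq_add2r.
- rewrite rpredD //; first by apply/polyOver_poly => i _; exact/polyOverP.
  apply: rpred_sum => i _; rewrite polyOverZ ?polyOverXn //.
  by rewrite !rpredM //; exact/polyOverP.
rewrite qy -[q in LHS]coefK nE poly_def big_ord_recr /= -poly_def !hornerD;
  congr (_ + _).
have uE : u = \sum_(i < m) p * r`_i.+1 * y^-1 ^+ i.+1.
  have <- : p * r.[y^-1] - p * r`_0 = u by rewrite -ry mulfV.
  rewrite horner_coef mE big_ord_recl /= expr0 mulr1 mulrDr [LHS]addrC addKr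
    mulr_sumr.
  by apply: eq_bigr => i _; rewrite mulrA.
rewrite hornerZ hornerXn horner_sum.
transitivity (q`_n * u^-1 * y ^+ n * u); first by rewrite mulrAC mulfVK.
rewrite {2}uE mulr_sumr; apply: eq_bigr => i _; rewrite hornerZ hornerXn.
have -> : y ^+ n = y ^+ (n - i.+1) * y ^+ i.+1.
  by rewrite -exprD subnK // (leq_trans (ltn_ord i)).
rewrite exprVn !mulrA mulrAC -!mulrA; congr (_ * (_ * _)).
by rewrite ![y ^+ (n - i.+1) * _]mulrC !mulrA; do 2!congr (_ * _);
  rewrite mulrAC mulfV ?expf_neq0 ?mul1r.
Qed.

Lemma avoiding_valuation : valuation_subring V.
Proof.
move=> y; have [|/avoiding_inv_horner[q qV qy]] := boolP (y \in V);
  first by left.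
have [|/avoiding_inv_horner[r rV ry]] := boolP (y^-1 \in V); first by right.
by case: (avoiding_no_both (ltnSn _) qV rV qy ry).
Qed.

End Avoiding.

Lemma valuation_integrally_closed (K : fieldType) (V : subringClosed K) :
  valuation_subring V -> integrally_closed_in V.
Proof.
move=> Vval x [q qmon qx];
  have q0 : subring_val (0 : subring_sort V) = 0 by exact: raddf0 \val.
have q1 : subring_val (1 : subring_sort V) = 1 by exact: rmorph1 \val.
apply: valuation_integral qx => //.
  by apply/polyOverP => i; rewrite coef_map_id0 //; exact: subring_valP.
by rewrite monicE lead_coef_map_id0 // (monicP qmon) ?q1 ?oner_neq0.
Qed.

(** * Maximal subrings attached to prime elements *)

(* [algebraic_along phi y] allows a non-injective phi, such as the map from the
   integers to a field of positive characteristic. *)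
Definition algebraic_along (R : nzRingType) (K : fieldType)
    (phi : R -> K) (y : K) : Prop :=
  exists2 q : {poly R}, map_poly phi q != 0 & root (map_poly phi q) y.

(** This is the property of a prime [a] of a principal ideal domain that is used: once the powers of
    [a] are removed from [b], the cofactor is comaximal with [a]. *)
Definition prime_power_split (R : comNzRingType) (a : R) : Prop :=
  forall b : R, b != 0 ->
    exists n c u v, b = a ^+ n * c /\ u * c + v * a = 1.

(** A strictly larger ring [T] contains the inverse of [phi a], hence of every nonzero [phi b] by
    the splitting. An algebraic equation of any [z] can then be made monic over [T], and [T], being
    a valuation ring, contains [z]. *)
Lemma avoiding_maximal (R : comNzRingType) (K : fieldType)
    (phi : {rmorphism R -> K}) (a : R) (V : subringClosed K) :
  injective phi -> prime_power_split a -> (forall y, algebraic_along phi y) ->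
  (forall b, phi b \in V) -> maximal_avoiding (phi a) V -> maximal_subring V.
Proof.
move=> phiI a_split alg phiV Vmax; have [_ aV _] := Vmax.
split; first by exists (phi a)^-1.
move=> T [z zT] VT; apply: contrapT => TV; case/negP: zT.
have Tval : valuation_subring T.
  by move=> y; have [/VT|/VT] := avoiding_valuation Vmax y; [left|right].
have aT : (phi a)^-1 \in T.
  have [_ _ /(_ T VT) TV'] := Vmax.
  by apply: contrapT => /negP /TV'.
have [q q0 qz] := alg z; pose c := lead_coef q.
have c0 : c != 0 by rewrite lead_coef_eq0; apply: contraNneq q0 => ->;
  rewrite map_poly0.
have cT : (phi c)^-1 \in T.
  have [n [b [u [v [-> uv]]]]] := a_split c c0.
  rewrite rmorphM rmorphXn invfM rpredM //; first by rewrite -exprVn rpredX.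
  (* The right-hand side is a unit of [V] by [avoiding_unit], so the cofactor [phi b] becomes
     invertible in [T]. *)
  have ub : phi u * phi b = 1 - phi a * phi v.
    by rewrite -(rmorph1 phi) -uv rmorphD !rmorphM [phi v * _]mulrC addrK.
  have : phi u / (phi u * phi b) \in T.
    by rewrite rpredM ?VT // ub; exact: avoiding_unit.
  have : phi u * phi b != 0.
    rewrite ub; apply: contraNneq aV => /eqP; rewrite subr_eq0 => /eqP ab.
    have a0 : phi a != 0 by apply: contra_eq_neq ab => ->;
      rewrite mul0r oner_neq0.
    by rewrite (_ : _^-1 = phi v) // -[LHS]mulr1 ab mulKf.
  by rewrite mulf_eq0 => /norP[u0 b0]; rewrite invfM mulrA mulfV ?mul1r.
have phic : phi c != 0 by rewrite (raddf_eq0 _ phiI).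
apply: (@valuation_integral _ T ((phi c)^-1 *: map_poly phi q)) => //.
- apply: polyOverZ => //; apply/polyOverP => i; rewrite coef_map; exact/VT/phiV.
- by rewrite monicE lead_coefZ lead_coef_map_eq // mulVf.
- by rewrite rootZ // invr_neq0.
Qed.

Lemma many_valuation_subrings (I : Type) (R : comNzRingType) (K : fieldType)
    (phi : {rmorphism R -> K}) (a : I -> R) :
  injective phi -> (forall y, algebraic_along phi y) ->
  (forall i, prime_power_split (a i)) -> (forall i, a i != 0) ->
  (forall i u, u * a i != 1) ->
  (forall i j, i <> j -> exists u v, u * a i + v * a j = 1) ->
  exists V : I -> subringClosed K,
    [/\ forall i, maximal_subring (V i), forall i, valuation_subring (V i)
      & forall i j, V i =i V j -> i = j].
Proof.
move=> phiI alg a_split a0 a_nunit a_comax.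
have phia0 i : phi (a i) != 0 by rewrite (raddf_eq0 _ phiI).
have [A AP] := subring_image phi.
have phiA b : phi b \in A by apply/AP; exists b.
have /choice[V VP] i : exists V : subringClosed K,
    {subset A <= V} /\ maximal_avoiding (phi (a i)) V.
  have [//||V AV Vmax] := @exists_maximal_avoiding K (phi (a i)) A.
    apply/negP => /AP[u uE]; case/eqP: (a_nunit i u).
    by apply: phiI; rewrite rmorphM rmorph1 -uE mulVf.
  by exists V.
exists V; split=> [i|i|i j Vij].
- have [AV Vmax] := VP i.
  by apply: avoiding_maximal Vmax => // b; exact: AV.
- by have [_ Vmax] := VP i; exact: avoiding_valuation Vmax.
(* If [V i] and [V j] agree, comaximality makes [phi (a j)] a unit modulo [phi (a i)], hence a unit
   of [V i]; but [V j] avoids its inverse. *)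
apply: contrapT => /a_comax[u [v uv]].
have [AVi Vmaxi] := VP i; have [AVj [_ /negP[]]] := VP j.
rewrite -Vij; have phiVi b : phi b \in V i by exact/AVi/phiA.
have vE : phi v * phi (a j) = 1 - phi (a i) * phi u.
  by rewrite -(rmorph1 phi) -uv rmorphD !rmorphM [phi u * _]mulrC addrAC subrr
    add0r.
have : phi v / (phi v * phi (a j)) \in V i.
  by rewrite rpredM // vE; exact: (avoiding_unit Vmaxi).
have : phi v * phi (a j) != 0.
  rewrite vE; have [_ aV _] := Vmaxi; apply: contraNneq aV => /eqP.
  rewrite subr_eq0 => /eqP ab.
  by rewrite (_ : _^-1 = phi u) // -[LHS]mulr1 ab mulKf.
by rewrite mulf_eq0 => /norP[v0 _]; rewrite invfM mulrA mulfV ?mul1r.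
Qed.

(** * Isomorphism classes of valuation subrings *)

Lemma subring_isomorphic_refl (K : fieldType) (S : subringClosed K) :
  subring_isomorphic S S.
Proof. by exists idfun; exact: (Bijective (g := idfun)). Qed.

Lemma subring_isomorphic_sym (K : fieldType) (S T : subringClosed K) :
  subring_isomorphic S T -> subring_isomorphic T S.
Proof.
move=> [f [g fK gK]].
have gB := can2_zmod_morphism fK gK; have gM := can2_monoid_morphism fK gK.
pose h : {rmorphism subring_sort T -> subring_sort S} :=
  HB.pack g (GRing.isZmodMorphism.Build _ _ g gB) (GRing.isMonoidMorphism.Build
    _ _ g gM).
by exists h; exact: (Bijective gK fK).
Qed.

Lemma subring_isomorphic_trans (K : fieldType) (S T U : subringClosed K) :
  subring_isomorphic S T -> subring_isomorphic T U -> subring_isomorphic S U.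
Proof. by move=> [f fb] [g gb]; exists (g \o f); exact: bij_comp. Qed.

(** [K] is the fraction field of [V], since each element or its inverse lies in [V]; the isomorphism
    therefore extends to fractions. *)
Lemma isomorphic_extends (K : fieldType) (V W : subringClosed K) :
  valuation_subring V -> valuation_subring W -> subring_isomorphic V W ->
  exists2 g : K -> K, field_aut K g & forall x, (g x \in W) = (x \in V).
Proof.
move=> Vval Wval [f [f' fK f'K]].
(* [e] is [f] read as a map on [K]; arguments outside [V] are replaced by 0. *)
pose e x := val (f (insubd 0 x)).
have eE x (xV : x \in V) : e x = val (f (SubringSort xV)).
  by rewrite /e; congr (val (f _)); apply: val_inj; rewrite val_insubd xV.
have eW x : e x \in W by exact: subring_valP.
have eB x y : x \in V -> y \in V -> e (x - y) = e x - e y.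
  move=> xV yV; have xyV : x - y \in V by rewrite rpredB.
  by rewrite !eE -!raddfB; congr (val (f _)); exact: val_inj.
have eM x y : x \in V -> y \in V -> e (x * y) = e x * e y.
  move=> xV yV; have xyV : x * y \in V by rewrite rpredM.
  by rewrite !eE -!rmorphM; congr (val (f _)); exact: val_inj.
have e1 : e 1 = 1.
  have V1 : 1 \in V by exact: rpred1.
  rewrite eE (_ : SubringSort V1 = 1) ?rmorph1 //; exact: val_inj.
have e0 : e 0 = 0 by rewrite -[in LHS](subrr 0) eB ?rpred0 // subrr.
have eN0 x : x \in V -> x != 0 -> e x != 0.
  move=> xV; apply: contra_neq; have V0 : 0 \in V by exact: rpred0.
  rewrite -[X in _ = X -> _]e0 !eE => /val_inj /(can_inj fK).
  by move=> /(congr1 val).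
have eS z : z \in W -> exists2 x, x \in V & e x = z.
  move=> zW; exists (val (f' (SubringSort zW))); first exact: subring_valP.
  by rewrite /e valKd f'K.
(* This form avoids choosing fractions; [gE] shows that it agrees with [e a / e b] on every
   fraction, from which additivity and multiplicativity follow. *)
pose g y := if y \in V then e y else (e y^-1)^-1.
have gE a b : a \in V -> b \in V -> b != 0 -> g (a / b) = e a / e b.
  move=> aV bV b0; rewrite /g; case: ifP => abV.
    by apply: (canRL (mulfK _)); rewrite ?eN0 // -eM // divfK.
  have a0 : a != 0 by apply: contraFneq abV => ->; rewrite mul0r rpred0.
  have baV : b / a \in V by move: (Vval (a / b)); rewrite abV invf_div => -[].
  by rewrite invf_div -(mulfK (eN0 a aV a0) (e (b / a))) -eM // divfK //
    invf_div.
have frac y : exists a b, [/\ a \in V, b \in V, b != 0 & y = a / b].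
  have [yV|yV] := Vval y; first by exists y, 1; rewrite rpred1 oner_neq0 divr1.
  have [->|y0] := eqVneq y 0.
    by exists 0, 1; rewrite rpred0 rpred1 oner_neq0 mul0r.
  by exists 1, y^-1; rewrite rpred1 invr_neq0 // invrK mul1r.
have gV x : x \in V -> g x = e x by rewrite /g => ->.
have gB : zmod_morphism g.
  move=> y z; have [a [b [aV bV b0 ->]]] := frac y.
  have [c [d [cV dV d0 ->]]] := frac z.
  rewrite -mulNr addf_div // mulNr !gE ?mulf_neq0 ?rpredB ?rpredM //.
  by rewrite eB ?eM ?rpredM // -[in RHS]mulNr addf_div ?eN0 // mulNr.
have gM : monoid_morphism g.
  split=> [|y z]; first by rewrite gV ?rpred1.
  have [a [b [aV bV b0 ->]]] := frac y.
  have [c [d [cV dV d0 ->]]] := frac z.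
  by rewrite mulf_div !gE ?mulf_neq0 ?rpredM // !eM // mulf_div.
pose h : {rmorphism K -> K} :=
  HB.pack g (GRing.isZmodMorphism.Build _ _ g gB) (GRing.isMonoidMorphism.Build
    _ _ g gM).
have gI : injective g := fmorph_inj h.
have gS z : exists x, g x = z.
  have [/eS[x xV <-]|/eS[x xV xz]] := Wval z; first by exists x; rewrite gV.
  by exists x^-1; rewrite -[g]/(h : K -> K) fmorphV /= gV // xz invrK.
have [g' g'K] := choice gS.
exists g; first by exists h; split=> //; exists g' => // x; apply: gI;
  rewrite g'K.
move=> x; apply/idP/idP => [/eS[y yV]|xV]; last by rewrite gV.
by rewrite -gV // => /gI <-.
Qed.

Lemma many_nonisomorphic (K : fieldType) (V : K -> subringClosed K) :
  infinite_set [set: K] -> card_lt (field_aut K) [set: K] ->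
  (forall x, maximal_subring (V x)) -> (forall x, valuation_subring (V x)) ->
  (forall x y, V x =i V y -> x = y) ->
  infinite_set (maximal_subring_classes K) /\
  exists F : set (subringClosed K),
    [/\ [set: K] #<= F,
        (forall S : subringClosed K, F S ->
           maximal_subring S /\ integrally_closed_in S)
      & (forall S T : subringClosed K, F S -> F T -> S <> T ->
           ~ subring_isomorphic S T)].
Proof.
move=> /injects_nat_infinite natK [_ KAut] Vmax Vval VI.
have [h hI] := natK.
pose Aut := {g : K -> K | field_aut K g}.
have nKAut : ~ injects K Aut by move=> /injects_sig_card_le.
have idAut : field_aut K id by exists idfun; split=> //;
  exact: (Bijective (g := idfun)).
(* [c (x, y)] is an automorphism carrying [V x] onto [V y] when the two are isomorphic, and the
   identity is the default otherwise. *)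
have /choice[c cP] : forall p : K * K, exists g : Aut,
    subring_isomorphic (V p.1) (V p.2) ->
    forall x, (sval g x \in V p.2) = (x \in V p.1).
  move=> [x y] /=; have [xy|nxy] := pselect (subring_isomorphic (V x) (V y)).
    have [g gA gE] := isomorphic_extends (Vval x) (Vval y) xy.
    by exists (exist _ g gA).
  by exists (exist _ id idAut).
have [x|x y|x y z|x y z xy xz cxyz|s sI] := @injects_small_classes K Aut
    (fun x y => subring_isomorphic (V x) (V y)) (fun x y => c (x, y))
    natK nKAut.
- exact: subring_isomorphic_refl.
- exact: subring_isomorphic_sym.
- exact: subring_isomorphic_trans.
(* One automorphism carries [V x] onto both [V y] and [V z], so these coincide; surjectivity is used
   to write [w] as an image. *)
- apply: VI => w; have := cP (x, y) xy; have := cP (x, z) xz; rewrite -cxyz /=.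
  have [g [[g' _ g'K] gE]] := svalP (c (x, y)).
  by rewrite gE -(g'K w) => -> ->.
split.
  apply/infiniteP; apply: (injects_card_le
    (f := fun n => [set T | subring_isomorphic (V (s (h n))) T])).
    by move=> n _; exists (V (s (h n))) => //; exact: Vmax.
  move=> m n _ _ /seteqP[_ /(_ (V (s (h n))))] mn.
  by apply/hI/sI/mn; exact: subring_isomorphic_refl.
exists (range (V \o s)); split.
- apply: (injects_card_le (f := V \o s)); first by move=> x _; exists x.
  by move=> x y _ _ /= E; apply: sI; have := subring_isomorphic_refl (V (s x));
    rewrite {2}E.
- by move=> _ [x _ <-]; split;
  [exact: Vmax|exact: (valuation_integrally_closed (Vval _))].
- by move=> _ _ [x _ <-] [y _ <-] /= nE /sI xy; apply: nE; rewrite xy.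
Qed.

(** * Cardinality of algebraic extensions, and the Frobenius map *)

Lemma roots_in_seq (K : fieldType) (p : {poly K}) :
  p != 0 -> exists s : seq K, forall x, root p x -> x \in s.
Proof.
elim: (size p) {-2}p (leqnn (size p)) => [|n IH] {}p sp p0.
  by move: sp; rewrite leqn0 size_poly_eq0 (negbTE p0).
have [[x px]|nr] := pselect (exists x, root p x); last first.
  by exists [::] => x px; case: nr; exists x.
have [q pE] := factor_theorem _ _ px.
have q0 : q != 0 by apply: contraNneq p0 => q0; rewrite pE q0 mul0r.
have [|s sP] := IH q _ q0.
  by move: sp; rewrite pE size_Mmonic ?monicXsubC // size_XsubC addn2.
exists (x :: s) => y; rewrite pE rootM root_XsubC inE orbC.
by case/orP => [->//|/sP ->]; rewrite orbT.
Qed.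

Lemma infinite_notin (T : choiceType) (s : seq T) :
  infinite_set [set: T] -> exists x, x \notin s.
Proof.
move=> infT; apply: contrapT => sT; apply/infT/finite_seqP; exists s.
apply/seteqP; split=> // x _ /=; apply: contrapT => xs; apply: sT; exists x.
exact/negP.
Qed.

(** Code [y] by the coefficient list of a polynomial vanishing at [y], together with the position of
    [y] in a fixed list of its roots. *)
Lemma injects_algebraic (R : nzRingType) (K : fieldType) (phi : R -> K)
    (M : Type) :
  injects nat M -> injects R M -> (forall y, algebraic_along phi y) ->
  injects K M.
Proof.
move=> natM RM alg; have /choice[q qP] : forall y, exists q : {poly R},
    map_poly phi q != 0 /\ root (map_poly phi q) y.
  by move=> y; have [q q0 qy] := alg y; exists q.
have /choice[rts rtsP] : forall q : {poly R}, exists s : seq K,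
    map_poly phi q != 0 -> forall x, root (map_poly phi q) x -> x \in s.
  move=> p; have [->|/roots_in_seq[s sP]] := eqVneq (map_poly phi p) 0.
    by exists [::].
  by exists s.
have : injects K (seq R * nat).
  exists (fun y => (q y : seq R, index y (rts (q y)))) => x y [/poly_inj qxy].
  have [qx0 qx] := qP x; have [qy0 qy] := qP y.
  move=> /(congr1 (nth 0 (rts (q x)))); rewrite nth_index ?rtsP // => ->.
  by rewrite qxy nth_index ?rtsP.
move=> /injects_trans; apply; apply: injects_trans (injects_square natM).
by apply: injects_prod => //; exact: injects_seq.
Qed.

Lemma field_aut_comp (K : fieldType) (f g : K -> K) :
  field_aut K f -> field_aut K g -> field_aut K (f \o g).
Proof.
move=> [f' [fb ->]] [g' [gb ->]]; exists (f' \o g'); split=> //=.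
exact: bij_comp.
Qed.

Lemma iter_eq_inj (T : Type) (f : T -> T) (x : T) (m n : nat) :
  injective f -> (m < n)%N -> iter m f x = iter n f x -> x = iter (n - m) f x.
Proof.
move=> fI mn; rewrite -{1}(subnKC (ltnW mn)) iterD.
by move: (n - m)%N => k; elim: m {mn} => //= m IH /fI.
Qed.

Lemma Frobenius_infinite_order (K : fieldType) (p : nat) :
  p \in [pchar K] -> infinite_set [set: K] ->
  (forall y, algebraic_along (intmul 1 : int -> K) y) ->
  injects nat {g : K -> K | field_aut K g}.
Proof.
move=> charK infK alg; pose F : {rmorphism K -> K} := pFrobenius_aut charK.
have p_gt1 : (1 < p)%N by rewrite prime_gt1 // (pcharf_prime charK).
have FI : injective F := fmorph_inj F.
have FS y : exists x, F x = y.
  have [q q0 qy] := alg y; have [s sP] := roots_in_seq q0.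
  (* Frobenius fixes the images of the integers, so it permutes the roots of [q]. *)
  have F_root x : root (map_poly (intmul 1) q) x -> root (map_poly (intmul 1)
    q) (F x).
    move=> /(rmorph_root F); rewrite -map_poly_comp.
    by rewrite (eq_map_poly (g := intmul 1)) // => z /=; rewrite rmorph_int.
  have ys n : iter n F y \in s by apply: sP; elim: n => //= n /F_root.
  have [m [n [mn mnE]]] : exists m n, (m < n)%N /\ iter m F y = iter n F y.
    apply: contrapT => H.
    (* Pigeonhole: [(size s).+1] distinct iterates would not fit in [s]. *)
    have : uniq [seq iter n F y | n <- iota 0 (size s).+1].
      rewrite map_inj_in_uniq ?iota_uniq // => m n _ _ mnE.
      have [mn|mn|//] := ltngtP m n; case: H; [exists m, n; split;
        [exact: mn|exact: mnE]|exists n, m; split; [exact: mn|exact: esym mnE]].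
    move=> /uniq_leq_size => /(_ s) /=; rewrite size_map size_iota ltnn.
    suff H' : {subset iter 0 F y :: [seq iter n F y | n <- iota 1 (size s)] <=
      s} by move/(_ H').
    by move=> x; rewrite inE => /predU1P[->|/mapP[k _ ->]].
  (* Injectivity turns the repetition into [y = iter (n - m) F y]; one iteration fewer is a preimage
     of [y]. *)
  exists (iter (n - m).-1 F y); rewrite -iterS prednK ?subn_gt0 //.
  exact/esym/iter_eq_inj.
have [F' F'K] := choice FS.
have FA : field_aut K F.
  by exists F; split=> //; exists F' => // x; apply: FI; rewrite F'K.
have FnA n : field_aut K (iter n F).
  elim: n => [|n IH]; last exact: field_aut_comp FA IH.
  by exists idfun; split=> //; exact: (Bijective (g := idfun)).
(* Equal iterates would make every [x] a root of the nonzero polynomial ['X^(p ^ (n - m)) - 'X],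
   impossible in an infinite field. *)
have F_lt m n : (m < n)%N -> iter m F = iter n F :> (K -> K) -> False.
  move=> mn mnE; have Fx x : x = iter (n - m) F x.
    by apply: iter_eq_inj => //; rewrite mnE.
  have FE k x : iter k F x = x ^+ (p ^ k).
    elim: k => [|k IH] /=; first by rewrite expr1.
    by rewrite IH pFrobenius_autE -exprM -expnSr.
  have N_gt1 : (1 < p ^ (n - m))%N by rewrite -{1}(expn0 p) ltn_exp2l //
    subn_gt0.
  have Xp0 : 'X^(p ^ (n - m)) - 'X != 0 :> {poly K}.
    rewrite -size_poly_eq0 size_polyDl ?size_polyXn // size_polyN size_polyX.
    by rewrite ltnS.
  have [s sP] := roots_in_seq Xp0; have [x /negP[]] := infinite_notin s infK.
  by apply: sP; rewrite rootE hornerD hornerN hornerX hornerXn -FE -Fx subrr.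
exists (fun n => exist _ (iter n F) (FnA n)) => m n [mnE].
by have [/F_lt/(_ mnE)|/F_lt/(_ (esym mnE))|] := ltngtP m n.
Qed.

(** * Prime elements of the integers and of [{poly E}] *)

Lemma prime_power_split_measure (R : comNzRingType) (a : R) (mu : R -> nat) :
  (forall b, b != 0 ->
     (exists c, [/\ c != 0, b = a * c & (mu c < mu b)%N]) \/
     (exists u v, u * b + v * a = 1)) ->
  prime_power_split a.
Proof.
(* Strong induction on [mu b]: each factor [a] divided out lowers [mu], so the process stops at a
   cofactor comaximal with [a]. *)
move=> H b; elim: (mu b) {-2}b (leqnn (mu b)) => [|N IH] {}b mub b0;
  have [[c [c0 bE cb]]|[u [v uv]]] := H b b0.
- by have := leq_trans cb mub.
- by exists 0%N, b, u, v; rewrite mul1r.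
- have [|n [d [u [v [cE uv]]]]] := IH c _ c0.
    by rewrite -ltnS (leq_trans cb).
  by exists n.+1, d, u, v; rewrite bE cE exprS mulrA.
- by exists 0%N, b, u, v; rewrite mul1r.
Qed.

Lemma split_prime (p : nat) : prime p -> prime_power_split (p%:Z).
Proof.
move=> pp; apply: (prime_power_split_measure (mu := absz)) => b b0.
have [pb|npb] := boolP (p%:Z %| b)%Z.
  left; have [c bE] := dvdzP pb; exists c.
  have c0 : c != 0 by apply: contraNneq b0 => c0; rewrite bE c0 mul0r.
  by split=> //; [rewrite mulrC|rewrite bE abszM ltn_Pmulr ?absz_gt0 //
    prime_gt1].
right; have /coprimezP[[u v] uv] : coprimez b p.
  by rewrite coprimezE coprime_sym prime_coprime.
by exists u, v.
Qed.

(** Requiring [q] monic picks one polynomial from each class of associates, so distinct ones are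
    comaximal. *)
Definition monic_irreducible (E : fieldType) (q : {poly E}) : Prop :=
  [/\ q \is monic, (1 < size q)%N
    & forall d, d %| q -> size d != 1 -> d %= q].

Lemma monic_irreducible_Bezout (E : fieldType) (a b : {poly E}) :
  monic_irreducible a -> ~~ (a %| b) -> exists u v, u * b + v * a = 1.
Proof.
move=> [amon sa airr] nab.
have : coprimep b a.
  rewrite coprimep_def; apply: contraNT nab => /(airr _ (dvdp_gcdr _ _)).
  by move=> /eqp_dvdl <-; exact: dvdp_gcdl.
move=> /Bezout_coprimepP[[u v] /=];
  rewrite -size_poly_eq1 => /size_poly1P[c c0 uv].
exists (c^-1 *: u), (c^-1 *: v); rewrite -!scalerAl -scalerDr uv.
by rewrite -mul_polyC -polyCM mulVf.
Qed.

Lemma split_monic_irreducible (E : fieldType) (a : {poly E}) :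
  monic_irreducible a -> prime_power_split a.
Proof.
move=> airr; apply: (prime_power_split_measure (mu := fun b : {poly E} =>
  size b)).
move=> b b0; have [ab|] := boolP (a %| b); last first.
  by right; exact: monic_irreducible_Bezout.
have [amon sa _] := airr.
left; exists (b %/ a); have bE := divpK ab.
have c0 : b %/ a != 0 by apply: contraNneq b0 => c0; rewrite -bE c0 mul0r.
split=> //; first by rewrite mulrC.
rewrite -[in ltnRHS]bE size_Mmonic //.
by case: (size a) sa => [|[|n]] // _; rewrite !addnS ltnS leq_addr.
Qed.

Lemma monic_irreducible_XsubC (E : fieldType) (c : E) :
  monic_irreducible ('X - c%:P).
Proof.
split; [exact: monicXsubC|by rewrite size_XsubC|move=> d dX d1].
have d0 : d != 0 by apply: contraTneq dX => ->; rewrite dvd0p polyXsubC_eq0.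
rewrite -dvdp_size_eqp // size_XsubC eqn_leq.
have := dvdp_leq (negbT (polyXsubC_eq0 c)) dX; rewrite size_XsubC => -> /=.
by move: d0 d1; rewrite -size_poly_eq0; case: (size d) => [|[]].
Qed.

(** Descend to a nonconstant divisor of smaller degree as long as one exists; otherwise [f] is
    irreducible and is rescaled to be monic. *)
Lemma exists_monic_irreducible (E : fieldType) (f : {poly E}) :
  (1 < size f)%N -> exists2 q, monic_irreducible q & q %| f.
Proof.
elim: (size f) {-2}f (leqnn (size f)) => [|N IH] {}f sfN sf.
  by rewrite leqNgt (ltnW sf) in sfN.
have f0 : f != 0 by rewrite -size_poly_gt0 (ltnW sf).
have lf0 : lead_coef f != 0 by rewrite lead_coef_eq0.
have [[d [df d1 ndf]]|nod] :=
  pselect (exists d, [/\ d %| f, size d != 1 & ~~ (d %= f)]).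
  have d0 : d != 0 by apply: contraTneq df => ->; rewrite dvd0p.
  have [||q qirr qd] := IH d.
  - rewrite -ltnS (leq_trans _ sfN) // ltn_neqAle dvdp_leq // andbT.
    by rewrite dvdp_size_eqp.
  - by move: d0 d1; rewrite -size_poly_eq0; case: (size d) => [|[]].
  by exists q => //; exact: dvdp_trans df.
exists ((lead_coef f)^-1 *: f); last by rewrite dvdpZl ?invr_neq0.
split; first by rewrite monicE lead_coefZ mulVf.
  by rewrite size_scale ?invr_neq0.
move=> d; rewrite dvdpZr ?invr_neq0 // => df d1.
apply: contrapT => /negP ndf; apply: nod; exists d; split=> //.
apply: contra ndf => /eqp_trans; apply; rewrite eqp_sym;
  exact/eqp_scale/invr_neq0.
Qed.

Lemma infinite_monic_irreducible (E : fieldType) :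
  infinite_set [set q : {poly E} | monic_irreducible q].
Proof.
move=> /finite_seqP[s sE]; pose P := \prod_(q <- s) q.
have sirr q : q \in s -> monic_irreducible q.
  by move=> qs; have : [set` s] q by []; rewrite -sE.
have Pmon : P \is monic.
  by rewrite /P big_seq; apply: monic_prod => q /sirr[].
have sXP : size ('X * P) = (size P).+1.
  by rewrite mulrC size_mulX // monic_neq0.
have P_gt0 : (0 < size P)%N by rewrite size_poly_gt0 monic_neq0.
(* Euclid's argument. The factor ['X] keeps the polynomial nonconstant even when [s] is empty and
   [P = 1]. *)
have [|q qirr qd] := @exists_monic_irreducible E ('X * P + 1).
  by rewrite size_polyDl sXP ?size_poly1 ltnS.
have qs : q \in s by have : [set` s] q by rewrite -sE.
have qP : q %| 'X * P by rewrite dvdp_mull // /P (big_rem q) //= dvdp_mulr.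
have := qd; rewrite dvdp_addr // dvdp1 => q1; have [_ + _] := qirr.
by rewrite (eqP q1).
Qed.

(** * Families of valuation rings indexed by [K] *)

Lemma lift_map_poly (R : nzRingType) (K : fieldType) (phi : R -> K)
    (p : {poly K}) :
  phi 0 = 0 -> (forall i, exists a, p`_i = phi a) ->
  exists q, map_poly phi q = p.
Proof.
move=> phi0 /choice[a aP]; exists (\poly_(i < size p) a i).
apply/polyP => i; rewrite coef_map_id0 // coef_poly.
case: ltnP => [_|/(nth_default 0) -> //]; exact/esym/aP.
Qed.

Definition has_many_valuations (K : fieldType) : Prop :=
  exists V : K -> subringClosed K,
    [/\ forall x, maximal_subring (V x), forall x, valuation_subring (V x)
      & forall x y, V x =i V y -> x = y].

Lemma has_many_valuations_inj (I : Type) (K : fieldType)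
    (V : I -> subringClosed K) :
  injects K I -> (forall i, maximal_subring (V i)) ->
  (forall i, valuation_subring (V i)) -> (forall i j, V i =i V j -> i = j) ->
  has_many_valuations K.
Proof.
move=> [f fI] Vmax Vval VI; exists (V \o f).
by split=> [x|x|x y /VI/fI] /=.
Qed.

(** [K] is algebraic over the integers, hence countable, so the infinitely many primes index enough
    rings. *)
Lemma many_valuations_int (K : fieldType) :
  [pchar K] =i pred0 -> (forall y, algebraic_along (intmul 1 : int -> K) y) ->
  has_many_valuations K.
Proof.
move=> /pcharf0P charK alg; pose phi : {rmorphism int -> K} := intmul 1.
have phiI : injective phi.
  apply: raddf_inj => -[] n; first by move=> /eqP;
    rewrite -[_ == _]/(n%:R == 0) charK => /eqP ->.
  move=> phin; have : n.+1%:R == 0 :> K by rewrite -oppr_eq0; exact/eqP/phin.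
  by rewrite charK.
have primes_inf : infinite_set [set p : nat | prime p].
  move=> /finite_seqP[s sE]; have [p] := prime_above (\max_(i <- s) i).
  move=> maxp pp; have : [set p | prime p] p by [].
  by rewrite sE /= => ps; move: maxp; rewrite ltnNge leq_bigmax_seq.
have [a [aI aP]] := infinite_seq primes_inf.
have [n|n|n u|m n mn|V [Vmax Vval VI]] :=
    @many_valuation_subrings nat int K phi (fun n => (a n)%:Z) phiI alg.
- exact/split_prime/aP.
- by have := prime_gt0 (aP n); rewrite lt0n.
- apply/eqP => /(congr1 absz); rewrite abszM => /eqP;
  rewrite muln_eq1 => /andP[_ /eqP a1].
  by have := aP n; rewrite -[a n]/(`|(a n)%:Z|)%N a1.
- have /coprimezP[[u v] uv] : coprimez (a m) (a n).
    rewrite coprimezE prime_coprime ?aP // dvdn_prime2 ?aP //.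
    by apply/negP => /eqP /aI.
  by exists u, v.
apply: has_many_valuations_inj Vmax Vval VI.
apply: injects_algebraic alg; first by exists id.
by exists pickle; exact: pcan_inj pickleK.
Qed.

Lemma many_valuations_poly (E K : fieldType) (iota : {rmorphism E -> K})
    (t : K) :
  let phi := fun p : {poly E} => (map_poly iota p).[t] in
  injective phi -> (forall y, algebraic_along phi y) -> has_many_valuations K.
Proof.
move=> phi phiI alg; pose psi : {rmorphism {poly E} -> K} :=
  horner_eval t \o map_poly iota.
have many (I : Type) (a : I -> {poly E}) : injects K I -> injective a ->
    (forall i, monic_irreducible (a i)) -> has_many_valuations K.
  move=> KI aI airr.
  have [i|i|i u|i j ij|V [Vmax Vval VI]] :=
      @many_valuation_subrings I {poly E} K psi a phiI alg.
  - exact: split_monic_irreducible.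
  - by have [/monic_neq0] := airr i.
  - apply/eqP => u1; have [_ + _] := airr i; rewrite ltnNge; case/negP.
    have : a i %| 1 by rewrite -u1 dvdp_mull.
    by rewrite dvdp1 => /eqP ->.
  - have [||u [v uv]] := @monic_irreducible_Bezout _ (a j) (a i) => //;
    last by exists u, v.
    apply/negP => aji; apply: ij; apply: aI; have [imon _ irr] := airr i.
    have [jmon sj _] := airr j.
    have : a j %= a i by apply: irr => //; rewrite neq_ltn sj orbT.
    by rewrite eqp_monic // => /eqP.
  exact: has_many_valuations_inj Vmax Vval VI.
(* [K] is algebraic over the image of [{poly E}], so any infinite [M] into which [E] embeds also
   receives [K]. This gives [M = E] with the primes ['X - c%:P] for [E] infinite, and [M = nat] for
   [E] finite. *)
have injK M : injects nat M -> injects E M -> injects K M.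
  move=> natM EM; apply: injects_algebraic alg => //.
  apply: injects_trans (injects_seq natM EM).
  by exists (fun p : {poly E} => p : seq E); exact: poly_inj.
have [finE|infE] := pselect (finite_set [set: E]); last first.
  apply: (many E (fun c => 'X - c%:P)); last exact: monic_irreducible_XsubC.
    by apply: injK; [exact/injects_nat_infinite|exists id].
  by move=> c d /(congr1 (fun p : {poly E} => - p`_0));
    rewrite !coefB !coefX !coefC /= !sub0r !opprK.
have [a [aI airr]] := infinite_seq (@infinite_monic_irreducible E).
apply: (many nat a) => //; apply: injK; first by exists id.
have /finite_seqP[s sE] := finE.
exists (index^~ s) => x y xy; have in_s z : z \in s.
  by have : [set: E] z by []; rewrite sE.
by rewrite -(nth_index 0 (in_s x)) xy nth_index.
Qed.

(** * Fields with an element transcendental over the prime ring *)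

Definition transcendental_over (K : fieldType) (S : subringClosed K) (t : K) :
  Prop :=
  forall p : {poly K}, p \is a polyOver S -> root p t -> p = 0.

(** Transcendence of [t] is a condition on finite lists of coefficients, so [Zorn_subring] applies.
    By maximality, adjoining any [y] outside [E] makes [t] algebraic. *)
Lemma maximal_transcendental (K : fieldType) (S : subringClosed K) (t : K) :
  transcendental_over S t ->
  exists E : subringClosed K, transcendental_over E t /\
    forall y, y \notin E -> exists p : {poly K},
      [/\ p != 0, root p t &
          forall i, exists2 q : {poly K}, q \is a polyOver E & p`_i = q.[y]].
Proof.
move=> St; pose Q (s : seq K) := root (Poly s) t -> Poly s = 0.
have QP (T : subringClosed K) :
    transcendental_over T t <-> forall s : seq K, {subset s <= T} -> Q s.
  split=> [Tt s sT|TQ p /allP pT pt].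
    apply: Tt; apply/polyOverP => i; rewrite coef_Poly.
    have [si|/(nth_default 0) ->] := ltnP i (size s); last exact: rpred0.
    exact/sT/mem_nth.
  by have := TQ p pT; rewrite /Q polyseqK; exact.
have [|E [SE /QP Et Emax]] := @Zorn_subring K Q S; first exact/QP.
exists E; split=> // y yE; apply: contrapT => nop; case/negP: yE.
have [T [ET yT TE]] := subring_adjoin E y.
apply: (Emax T ET) => //; apply/QP => p /polyOverP pT pt.
apply: contrapT => /eqP p0; apply: nop; exists p; split=> // i.
exact: TE.
Qed.

(** Otherwise [t] is a root of a nonzero polynomial whose coefficients are polynomials in [x^-1]
    over [E]; a large power of [x] clears these denominators and contradicts transcendence. *)
Lemma maximal_transcendental_inv (K : fieldType) (E : subringClosed K)
    (t x : K) :
  transcendental_over E t ->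
  (forall y, y \notin E -> exists p : {poly K},
      [/\ p != 0, root p t &
          forall i, exists2 q : {poly K}, q \is a polyOver E & p`_i = q.[y]]) ->
  x \in E -> x^-1 \in E.
Proof.
move=> Et Emax xE; have [->|x0] := eqVneq x 0; first by rewrite invr0 rpred0.
have [//|/Emax[p [p0 pt pE]]] := boolP (x^-1 \in E).
have /choice[q qE] : forall i,
    exists q : {poly K}, q \is a polyOver E /\ p`_i = q.[x^-1].
  by move=> i; have [q qE pq] := pE i; exists q.
pose N := \max_(i < size p) size (q i).
case/eqP: p0; apply/(scalerI (expf_neq0 N x0)); rewrite scaler0.
apply: Et; last by rewrite rootZ // expf_neq0.
apply/polyOverP => i; rewrite coefZ mulrC.
have [ip|/(nth_default 0) ->] := ltnP i (size p); last by rewrite mul0r rpred0.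
have [qi ->] := qE i; apply: horner_inv_mem => //; apply: leqW.
by have := @leq_bigmax _ (fun j : 'I_(size p) => size (q j)) (Ordinal ip).
Qed.

Lemma many_valuations_transcendental (K : fieldType) (t : K) :
  ~ algebraic_along (intmul 1 : int -> K) t -> has_many_valuations K.
Proof.
move=> nalg; have [S SP] := @subring_image int K (intmul 1).
have St : transcendental_over S t.
  move=> p /polyOverP pS pt; apply: contrapT => /eqP p0; apply: nalg.
  have [//|i|q qp] := @lift_map_poly int K (intmul 1) p; first exact/SP.
  by exists q; rewrite qp.
have [E [Et Emax]] := maximal_transcendental St.
pose R := subring_sort E.
pose inv (x : R) : R := insubd 0 (val x)^-1.
have inv_val x : subring_val (inv x) = (subring_val x)^-1.
  by rewrite [LHS]val_insubd (maximal_transcendental_inv Et Emax (valP x)).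
have val0 : subring_val (0 : R) = 0 by exact: (raddf0 \val).
have mulVx (x : R) : x != 0 -> inv x * x = 1.
  move=> x0; apply: val_inj;
    have -> : \val (inv x * x) = \val (inv x) * \val x by exact: rmorphM.
  have -> : \val (1 : R) = 1 by exact: (rmorph1 \val).
  by rewrite /= inv_val mulVf.
have inv0 : inv 0 = 0 by apply: val_inj; rewrite /= inv_val val0 invr0.
pose F : fieldType := HB.pack R (GRing.ComNzRing_isField.Build R mulVx inv0).
pose iota : {rmorphism F -> K} := (val : R -> K).
have iotaP (q : {poly K}) : q \is a polyOver E ->
    exists a : {poly F}, map_poly iota a = q.
  move=> /polyOverP qE; apply: lift_map_poly => [|i]; first exact: rmorph0.
  by exists (SubringSort (qE i)).
have map_iotaE (p : {poly F}) : map_poly iota p \is a polyOver E.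
  by apply/polyOverP => i; rewrite coef_map; exact: subring_valP.
pose psi z : {rmorphism {poly F} -> K} := horner_eval z \o map_poly iota.
have psiI : injective (psi t).
  apply: raddf_inj => p /= /eqP pt; apply: (map_poly_inj iota); rewrite rmorph0.
  exact: Et.
apply: (@many_valuations_poly F K iota t) => [|y]; first exact: psiI.
suff : algebraic_along (psi t) y by [].
have [yE|/Emax[p [p0 pt pE]]] := boolP (y \in E).
  have -> : y = psi t (SubringSort yE : F)%:P.
    by rewrite -[RHS]/((map_poly iota (SubringSort yE :
      F)%:P).[t]) map_polyC hornerC.
  set c := _%:P; have XcE : map_poly (psi t) ('X - c%:P) = 'X - (psi t c)%:P.
    by rewrite map_polyXsubC.
  by exists ('X - c%:P); rewrite XcE ?polyXsubC_eq0 ?root_XsubC.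
(* [G] is a polynomial in two variables over [F]: specializing the inner one to [y] gives [p], which
   vanishes at [t]. *)
have [|i|G Gp] := @lift_map_poly {poly F} K (psi y) p; first exact: rmorph0.
  by have [q /iotaP[a <-] ->] := pE i; exists a.
have map_psi z H : map_poly (psi z) H =
    map_poly (horner_eval z) (map_poly (map_poly iota) H).
  by rewrite -map_poly_comp.
have horner_psi z w (U : {poly {poly K}}) :
    (map_poly (horner_eval z) U).[w] = U.[w, z].
  by rewrite -[w in LHS](hornerC w z) -[(w%:P).[z]]/(horner_eval z w%:P)
    horner_map.
(* Exchanging the variables reads the same relation as an equation for [y] with coefficients in
   [F[t]]; it stays nonzero because [psi t] is injective. *)
exists (swapXY G).
  rewrite -(rmorph0 (map_poly (psi t))) (inj_eq (map_inj_poly psiI _)) ?rmorph0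
    //.
  by rewrite swapXY_eq0; apply: contraNneq p0 => G0; rewrite -Gp G0 rmorph0.
rewrite rootE map_psi horner_psi -swapXY_map horner2_swapXY -horner_psi
  -map_psi.
by rewrite Gp -rootE.
Qed.

Theorem proposition3p20 (K : fieldType)
    (K_infinite : infinite_set [set: K])
    (card_aut_lt : card_lt (field_aut K) [set: K]) :
  infinite_set (maximal_subring_classes K) /\
  exists F : set (subringClosed K),
    [/\ [set: K] #<= F,
        (forall S : subringClosed K, F S ->
           maximal_subring S /\ integrally_closed_in S)
      & (forall S T : subringClosed K, F S -> F T -> S <> T ->
           ~ subring_isomorphic S T)].
Proof.
suff [V [Vmax Vval VI]] : has_many_valuations K by exact: many_nonisomorphic VI.
have [alg|/existsNP[t]] :=
    pselect (forall y, algebraic_along (intmul 1 : int -> K) y); last first.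
  exact: many_valuations_transcendental.
have [[p charK]|char0] := pselect (exists p, p \in [pchar K]); last first.
  apply: many_valuations_int => // p; apply/negbTE/negP => charK.
  by apply: char0; exists p.
(* In this case [K] embeds in [nat] and [nat] embeds in the automorphisms through Frobenius, against
   the strict inequality. *)
have [_ []] := card_aut_lt.
have int_nat : injects int nat by exists pickle; exact: pcan_inj pickleK.
have id_nat : injects nat nat by exists id.
have := injects_trans (injects_algebraic id_nat int_nat alg)
  (Frobenius_infinite_order charK K_infinite alg).
exact: injects_sig_card_le.
Qed.
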